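(* For all $n\ge1$ and $m\ge0$: (i) The sets $\mathcal T^+_{\infty,2}(n,m)$, $\mathcal{PT}(n,m)$ and $\mathcal{SP}^+(n,m)$ are in bijection, via bijections $$\varphi^+:\mathcal T^+_{\infty,2}(n,m)\xrightarrow{f^+}\mathcal{PT}(n,m)\xrightarrow{g^+}\mathcal{SP}^+(n,m).$$ (ii) The sets $\mathcal T^0_{\infty,2}(n,m)$, $\mathcal{PT}(n,m+1)$ and $\mathcal{SP}^0(n,m)$ are in bijection, via bijections $$\varphi^0:\mathcal T^0_{\infty,2}(n,m)\xrightarrow{f^0}\mathcal{PT}(n,m+1)\xrightarrow{g^0}\mathcal{SP}^0(n,m).$$ Moreover, there is a bijection $T:\mathcal{SP}^+(n,m+1)\to\mathcal{SP}^0(n,m)$ such that $\varphi^0=T\circ\varphi^+\circ\beta_{\infty,2}$ as maps $\mathcal T^0_{\infty,2}(n,m)\to\mathcal{SP}^0(n,m)$, where $\beta_{\infty,2}:\mathcal T^0_{\infty,2}(n,m)\to\mathcal T^+_{\infty,2}(n,m+1)$ is the map that changes the root label from $0$ to $1$ (and $\varphi^+$ here is the bijection of (i) for the indices $(n,m+1)$). (iii) The bijections $\varphi^+$ and $\varphi^0$ restrict to bijections $$\psi^+:\mathcal T^+_{2,2}(n,m)\to\mathcal{RP}^+(n,m),\qquad\psi^0:\mathcal T^0_{2,2}(n,m)\to\mathcal{RP}^0(n,m).$$ That is, there exist families of bijections $f^+,g^+,f^0,g^0,T$ (indexed by $n,m$) with all these properties.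
   Context: \textbf{Decorated trees.} In a rooted planar tree, a node is a leaf if it has no children and internal otherwise; an angle is the sector between two consecutive children of an internal node. $\mathcal T_{\infty,2}$ is the set of finite rooted planar trees with at least one internal node, with each angle labeled by a positive integer and each internal node labeled by $0$ or $1$, such that: every internal node has at least two children; among the children of each node only the leftmost and rightmost can be leaves; only the root may have label $0$ (all other internal nodes have label $1$). $\mathcal T_{2,2}\subseteq\mathcal T_{\infty,2}$ is the subset of trees all of whose angle labels are $1$. For a decorated tree $t$, $\deg_{\mathrm{node}}(t)$ is the sum of the labels of its internal nodes and $\deg_{\mathrm{angle}}(t)$ the sum of its angle labels. For $n\ge1$, $m\ge0$, $\mathcal T_{i,2}(n,m)$ ($i\in\{2,\infty\}$) is the set of $t\in\mathcal T_{i,2}$ with $\deg_{\mathrm{angle}}(t)=n$ and $\deg_{\mathrm{node}}(t)=m$; $\mathcal T^+_{i,2}(n,m)$ and $\mathcal T^0_{i,2}(n,m)$ are the subsets of those with root label $1$ and $0$ respectively. \textbf{Planar trees.} $\mathcal{PT}(n,m)$ is the set of (undecorated) rooted planar trees, all of whose internal nodes have at least two children, with $n+1$ leaves and $m$ internal nodes. \textbf{Paths.} $\mathcal{SP}(n,m)$ is the set of Schr\''oder paths with $n-m$ diagonal steps: lattice paths from $(0,0)$ to $(n,n)$ with steps $H=(1,0)$, $V=(0,1)$, $D=(1,1)$, never rising above the diagonal $y=x$, with exactly $n-m$ steps $D$. $\mathcal{RP}(n,m)$ is the subset of paths in $\mathcal{SP}(n,m)$ in which each diagonal step is followed by a horizontal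 step, except if it is the last step of the path. $\mathcal{SP}^+(n,m)$ (resp. $\mathcal{RP}^+(n,m)$) is the subset of paths in $\mathcal{SP}(n,m)$ (resp. $\mathcal{RP}(n,m)$) having no diagonal step lying on the diagonal $y=x$; $\mathcal{SP}^0(n,m)$ (resp. $\mathcal{RP}^0(n,m)$) is its complement in $\mathcal{SP}(n,m)$ (resp. $\mathcal{RP}(n,m)$). *)

(* Defs.v *)
From mathcomp Require Import all_boot.
From mathcomp Require Import boolp classical_sets functions.

Set Implicit Arguments.
Unset Strict Implicit.
Unset Printing Implicit Defensive.

Local Open Scope classical_set_scope.

(* [DNode b t0 [:: (a1, t1); ...; (ak, tk)]] is an internal node with label [b]
   ([false] is 0, [true] is 1) and children t0, ..., tk from left to right;
   [ai] labels the angle between t(i-1) and ti. *)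
Inductive dtree : Type :=
  | DLeaf
  | DNode of bool & dtree & seq (nat * dtree).

Definition d_internal (t : dtree) : bool :=
  if t is DNode _ _ _ then true else false.

(* Preorder: the label of the root comes first. *)
Fixpoint node_labels (t : dtree) : seq bool :=
  if t is DNode b t0 s
  then b :: node_labels t0 ++ flatten [seq node_labels c.2 | c <- s]
  else [::].

Fixpoint angle_labels (t : dtree) : seq nat :=
  if t is DNode _ t0 s
  then angle_labels t0 ++ flatten [seq c.1 :: angle_labels c.2 | c <- s]
  else [::].

(* [behead (belast t0 cs)] lists the children t0 :: cs without the leftmost and
   the rightmost one. *)
Fixpoint d_shape (t : dtree) : bool :=
  if t is DNode _ t0 s
  then let cs := unzip2 s in
       [&& 1 < size (t0 :: cs), all d_internal (behead (belast t0 cs)),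
           d_shape t0 & all (fun c => d_shape c.2) s]
  else true.

Definition deg_node (t : dtree) : nat := sumn [seq nat_of_bool b | b <- node_labels t].
Definition deg_angle (t : dtree) : nat := sumn (angle_labels t).

Definition Tinf2 : set dtree :=
  [set t | [/\ d_internal t, d_shape t,
               all (fun a => 0 < a) (angle_labels t)
             & all (pred1 true) (behead (node_labels t))]].

Definition T22 : set dtree :=
  [set t | Tinf2 t /\ all (pred1 1) (angle_labels t)].

Definition of_degree (n m : nat) : set dtree :=
  [set t | deg_angle t = n /\ deg_node t = m].

Definition root_label (b : bool) : set dtree :=
  [set t | exists t0 s, t = DNode b t0 s].

Definition Tinf2_plus (n m : nat) := Tinf2 `&` of_degree n m `&` root_label true.
Definition Tinf2_zero (n m : nat) := Tinf2 `&` of_degree n m `&` root_label false.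
Definition T22_plus (n m : nat) := T22 `&` of_degree n m `&` root_label true.
Definition T22_zero (n m : nat) := T22 `&` of_degree n m `&` root_label false.

(* Only meaningful on trees with root label 0. *)
Definition beta (t : dtree) : dtree :=
  if t is DNode _ t0 s then DNode true t0 s else DLeaf.

Lemma beta_fun (n m : nat) : set_fun (Tinf2_zero n m) (Tinf2_plus n m.+1) beta.
Proof.
move=> t [[[_ sh ha hn] [da dn]] [t0 [s tE]]]; subst t.
split; last by exists t0, s.
by split; split=> //; rewrite -dn.
Qed.

(* A leaf is [PNode [::]]. *)
Inductive ptree : Type := PNode of seq ptree.

Fixpoint p_leaves (t : ptree) : nat :=
  let: PNode s := t in if nilp s then 1 else sumn [seq p_leaves u | u <- s].

Fixpoint p_internals (t : ptree) : nat :=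
  let: PNode s := t in if nilp s then 0 else (sumn [seq p_internals u | u <- s]).+1.

Fixpoint p_shape (t : ptree) : bool :=
  let: PNode s := t in (nilp s || (1 < size s)) && all p_shape s.

Definition PT (n m : nat) : set ptree :=
  [set t | [/\ p_shape t, p_leaves t = n.+1 & p_internals t = m]].

Inductive step : Type := Hstep | Vstep | Dstep.

Definition path_x (p : seq step) : nat :=
  count (fun s => if s is Vstep then false else true) p.
Definition path_y (p : seq step) : nat :=
  count (fun s => if s is Hstep then false else true) p.
Definition diag_steps (p : seq step) : nat :=
  count (fun s => if s is Dstep then true else false) p.

(* The equation on [diag_steps] says that there are n - m diagonal steps,
   without truncated subtraction: the set is empty for n < m. *)
Definition SP (n m : nat) : set (seq step) :=
  [set p | [/\ path_x p = n, path_y p = n, diag_steps p + m = n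
             & forall q r, p = q ++ r -> path_y q <= path_x q]].

Definition RP (n m : nat) : set (seq step) :=
  [set p | SP n m p /\
     forall q r, p = q ++ Dstep :: r -> r = [::] \/ exists r', r = Hstep :: r'].

Definition no_diag_on_diagonal : set (seq step) :=
  [set p | forall q r, p = q ++ Dstep :: r -> path_x q <> path_y q].

Definition SP_plus (n m : nat) := SP n m `&` no_diag_on_diagonal.
Definition SP_zero (n m : nat) := SP n m `\` SP_plus n m.
Definition RP_plus (n m : nat) := RP n m `&` no_diag_on_diagonal.
Definition RP_zero (n m : nat) := RP n m `\` RP_plus n m.

(* Main.v *)
Require Import Defs.
From mathcomp Require Import all_boot.
From mathcomp Require Import boolp classical_sets functions.
From mathcomp Require Import zify.

Set Implicit Arguments.
Unset Strict Implicit.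
Unset Printing Implicit Defensive.

Local Open Scope classical_set_scope.

(** Both f^+ and f^0 are [expand]: an angle label a records that a - 1 leaves
    have been pulled out of the angle, so putting them back yields a planar
    tree. Nothing is lost, because the inner children of a decorated node are
    internal: in a planar tree the leaves among the inner children are exactly
    the ones to be removed again ([compress]). A planar tree has one angle
    less than it has leaves, whence the angle degree. The root label is
    ignored, so that f^0 is f^+ after [beta].

    For the paths, decompose a nonempty path without diagonal step on the
    diagonal at its first return, as H Q V R, and cut Q at those of its
    diagonal steps that lie at the level where Q starts and ends: Q = Q_0 D Q_1 D ... D Q_(k-1). The k + 1 pieces
    Q_0, ..., Q_(k-1), R are again paths without diagonal step on the diagonal,
    and they are the children of the root. So g^+ is [word],
      word (c_0, ..., c_k) =
        H word(c_0) D word(c_1) D ... D word(c_(k-1)) V word(c_k).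
    More generally, cutting an arbitrary Schroeder path at its diagonal steps on
    the diagonal shows that Schroeder paths correspond to nonempty sequences of
    planar trees ([forest_word]), and that the path has no diagonal step on the
    diagonal exactly when the sequence is a singleton. Sequences of length at
    least two are the children of the root of an internal node, and this gives
    g^0 = [children_word],
      children_word (c_0, ..., c_k) = word(c_0) D word(c_1) D ... D word(c_k).
    In terms of paths, T sends H Q V R to Q D R.
    The inverse of [forest_word] is [parse], a stack machine reading the path
    from right to left.

    All angle labels are 1 exactly when no inner child in the planar tree is a
    leaf ([tight]). In both words each D that is not followed by the last
    child is followed by the word of an inner child, which starts with H if
    the child is internal, and is empty if it is a leaf, in which case the next
    step is D or V. The D before the last child c_k occurs in [children_word]
    only, and it is followed by H or ends the path. So the trees with angle
    labels 1 correspond to the paths in which D is followed by H or is last. *)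

(** * Bijections between sets *)

Lemma set_bij_can (T U : Type) (A : set T) (B : set U) (f : T -> U) (g : U -> T) :
  (forall x, A x -> B (f x)) -> (forall y, B y -> A (g y)) ->
  (forall x, A x -> g (f x) = x) -> (forall y, B y -> f (g y) = y) ->
  set_bij A B f.
Proof.
move=> fAB gBA fK gK; split=> [x /fAB //|x y|y By].
  by rewrite !inE => Ax Ay fxy; rewrite -(fK x) // fxy fK.
by exists (g y); [exact: gBA | exact: gK].
Qed.

Lemma set_bij_sep (T U : Type) (A : set T) (B : set U) (P : set T) (Q : set U)
    (f : T -> U) :
  (forall x, A x -> P x <-> Q (f x)) -> set_bij A B f ->
  set_bij (A `&` P) (B `&` Q) f.
Proof.
move=> PQ [fAB fI fS]; split=> [x [Ax Px]|x y|y [By Qy]].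
- by split; [exact: fAB | exact/PQ].
- by rewrite !inE => -[Ax _] [Ay _]; apply: fI; rewrite inE.
- have [x Ax fx] := fS y By; exists x => //.
  by split=> //; apply/PQ => //; rewrite fx.
Qed.

(** Used to obtain T, the factor of g^0 through g^+. *)
Lemma set_bij_factor (S T U : Type) (A : set S) (B : set T) (C : set U)
    (f : S -> T) (g : T -> U) :
  set_bij A B f -> set_bij A C (g \o f) -> set_bij B C g.
Proof.
move=> [fAB fI fS] [gAC gI gS]; split=> [y By|y1 y2|z Cz].
- by have [x Ax <-] := fS y By; apply: gAC.
- rewrite !inE => /fS [x1 Ax1 <-] /fS [x2 Ax2 <-] eg.
  by congr f; apply: gI; rewrite ?inE.
- by have [x Ax gx] := gS z Cz; exists (f x) => //; apply: fAB.
Qed.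

(** * Induction on trees *)

(** The automatically generated induction principle gives no hypothesis on the
    subtrees, which are nested in a list; [Q] is the property of the forests. *)
Lemma ptree_forest_ind (P : ptree -> Prop) (Q : seq ptree -> Prop) :
  Q [::] -> (forall t s, P t -> Q s -> Q (t :: s)) ->
  P (PNode [::]) -> (forall t s, P t -> Q s -> P (PNode (t :: s))) ->
  (forall t, P t) /\ (forall s, Q s).
Proof.
move=> Q0 QS PL PN.
have PT : forall t, P t.
  fix IH 1 => -[[//|u s]]; apply: PN; first exact: IH.
  by elim: s => [//|t s IHs]; apply: QS.
by split=> //; elim=> // t s IHs; apply: QS.
Qed.

Lemma dtree_forest_ind (P : dtree -> Prop) (Q : seq (nat * dtree) -> Prop) :
  Q [::] -> (forall a t s, P t -> Q s -> Q ((a, t) :: s)) ->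
  P DLeaf -> (forall b t s, P t -> Q s -> P (DNode b t s)) ->
  (forall t, P t) /\ (forall s, Q s).
Proof.
move=> Q0 QS PL PN.
have PT : forall t, P t.
  fix IH 1 => -[//|b v s]; apply: PN; first exact: IH.
  by elim: s => [//|[a u] s IHs]; apply: QS.
by split=> //; elim=> // -[a t] s IHs; apply: QS.
Qed.

(** * Decorated trees and planar trees *)

Definition leaf := PNode [::].

Definition p_internal (t : ptree) : bool :=
  let: PNode s := t in ~~ nilp s.

Fixpoint expand (t : dtree) : ptree :=
  if t is DNode _ t0 s
  then PNode (expand t0 ::
              flatten [seq rcons (nseq c.1.-1 leaf) (expand c.2) | c <- s])
  else leaf.

(** The fixpoint [expand] has to inline this function, to be accepted as
    structurally recursive. *)
Definition expand_forest (s : seq (nat * dtree)) : seq ptree :=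
  flatten [seq rcons (nseq c.1.-1 leaf) (expand c.2) | c <- s].

Lemma expand_forest_cons a t s :
  expand_forest ((a, t) :: s) =
  nseq a.-1 leaf ++ expand t :: expand_forest s.
Proof. by rewrite /expand_forest /= cat_rcons. Qed.

(** The children are scanned from right to left. A leaf that is not the last
    child disappears into the angle on its right, any other child opens an angle
    with label 1. *)
Definition add_child (t : dtree) (s : seq (nat * dtree)) : seq (nat * dtree) :=
  if s is (a, u) :: s' then
    if d_internal t then (1, t) :: s else (a.+1, u) :: s'
  else [:: (1, t)].

Fixpoint compress (t : ptree) : dtree :=
  let: PNode s := t in
  if [seq compress u | u <- s] is t0 :: s'
  then DNode true t0 (foldr add_child [::] s') else DLeaf.

Definition compress_forest (s : seq ptree) : seq (nat * dtree) :=
  foldr add_child [::] [seq compress u | u <- s].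

Lemma compress_node t s :
  compress (PNode (t :: s)) = DNode true (compress t) (compress_forest s).
Proof. by []. Qed.

Lemma compress_forest_cons t s :
  compress_forest (t :: s) = add_child (compress t) (compress_forest s).
Proof. by []. Qed.

Lemma d_internal_compress t : d_internal (compress t) = p_internal t.
Proof. by case: t => -[]. Qed.

Lemma p_internal_expand t : p_internal (expand t) = d_internal t.
Proof. by case: t. Qed.

Lemma p_internalPn t : ~~ p_internal t -> t = leaf.
Proof. by case: t => -[]. Qed.

(** The trees of [Tinf2] with root label 1, and the leaf: unlike membership in
    [Tinf2], this condition is inherited by subtrees. *)
Fixpoint proper (t : dtree) : bool :=
  if t is DNode b t0 s
  then [&& b, 0 < size s, all d_internal (behead (belast t0 (unzip2 s))),
           proper t0 & all (fun c => (0 < c.1) && proper c.2) s]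
  else true.

Definition proper_forest (s : seq (nat * dtree)) : bool :=
  all (fun c => (0 < c.1) && proper c.2) s.

Lemma properE t :
  proper t = [&& d_shape t, all (fun a => 0 < a) (angle_labels t)
                & all (pred1 true) (node_labels t)].
Proof.
move: t; apply: (dtree_forest_ind (Q := fun s =>
  proper_forest s = [&& all (fun c => d_shape c.2) s,
    all (fun a => 0 < a) (flatten [seq c.1 :: angle_labels c.2 | c <- s])
    & all (pred1 true) (flatten [seq node_labels c.2 | c <- s])]) _ _ _ _).1 => //=.
- move=> a t s -> ->; rewrite !all_cat.
  by do !case: (all _ _) => //=; rewrite ?andbF ?andbT //;
    case: (d_shape t); rewrite ?andbF ?andbT.
move=> b t s; rewrite /proper_forest => -> ->; rewrite !all_cat size_map eqb_id ltnS.
by case: b => //=; do !case: (all _ _) => //=; rewrite ?andbF ?andbT // andbC.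
Qed.

(** [behead (belast x s)] is [s] without its last element, whatever [x] is. *)
Lemma all_inner_cons (T : Type) (P : pred T) (x y : T) s :
  all P (behead (belast x (y :: s))) =
  (nilp s || P y) && all P (behead (belast x s)).
Proof. by case: s. Qed.

Lemma nilp_expand_forest s : nilp (expand_forest s) = nilp s.
Proof.
case: s => // -[a t] s; rewrite /expand_forest /= /nilp size_cat size_rcons.
by rewrite addSn.
Qed.

Lemma p_shape_expand t : proper t -> p_shape (expand t).
Proof.
move: t; apply: (dtree_forest_ind (Q := fun s =>
  proper_forest s -> all p_shape (expand_forest s)) _ _ _ _).1 => //.
  move=> a t s IHt IHs /=; rewrite -/(proper_forest s) => /andP[/andP[_ /IHt sht] /IHs shs].
  rewrite /expand_forest /= all_cat shs andbT all_rcons sht /=.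
  by elim: a.-1.
move=> b t s IHt IHs /= /and5P[_ s0 _ /IHt -> /IHs shs] /=.
rewrite -/(expand_forest s) shs andbT.
by have := nilp_expand_forest s; rewrite /nilp; lia.
Qed.

Lemma p_leaves_expand t : proper t -> p_leaves (expand t) = (deg_angle t).+1.
Proof.
move: t; apply: (dtree_forest_ind (Q := fun s => proper_forest s ->
  sumn [seq p_leaves u | u <- expand_forest s] =
  sumn (flatten [seq c.1 :: angle_labels c.2 | c <- s])) _ _ _ _).1 => //.
  move=> a t s IHt IHs /andP[/andP[/= a0 /IHt et] /IHs es].
  rewrite /expand_forest /= map_cat sumn_cat -/(expand_forest s) es sumn_cat.
  rewrite map_rcons sumn_rcons map_nseq sumn_nseq et /deg_angle /=.
  by lia.
move=> b t s IHt IHs /and5P[_ _ _ /IHt et /IHs es] /=.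
by rewrite -/(expand_forest s) es et /deg_angle /= sumn_cat addSn.
Qed.

Lemma p_internals_expand t : proper t -> p_internals (expand t) = deg_node t.
Proof.
move: t; apply: (dtree_forest_ind (Q := fun s => proper_forest s ->
  sumn [seq p_internals u | u <- expand_forest s] =
  sumn [seq nat_of_bool b | b <- flatten [seq node_labels c.2 | c <- s]]) _ _ _ _).1 => //.
  move=> a t s IHt IHs /andP[/andP[/= a0 /IHt et] /IHs es].
  rewrite /expand_forest /= map_cat sumn_cat -/(expand_forest s) es map_cat sumn_cat.
  by rewrite map_rcons sumn_rcons map_nseq sumn_nseq et.
move=> b t s IHt IHs /and5P[-> _ _ /IHt et /IHs es] /=.
by rewrite -/(expand_forest s) es et /deg_node /= map_cat sumn_cat.
Qed.

Lemma add_leaves k a t s :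
  iter k (add_child DLeaf) ((a, t) :: s) = (a + k, t) :: s.
Proof. by elim: k => [|k /= ->]; rewrite ?addn0 ?addnS. Qed.

(** The leaves inserted in the angle before [t] are absorbed into the angle that
    [t] has just opened; that [t] opens an angle needs [t] to be last or
    internal. *)
Lemma expandK t : proper t -> compress (expand t) = t.
Proof.
move: t; apply: (dtree_forest_ind (Q := fun s =>
  proper_forest s -> all d_internal (behead (belast DLeaf (unzip2 s))) ->
  compress_forest (expand_forest s) = s) _ _ _ _).1 => //.
  move=> a t s IHt IHs /andP[/andP[/= a0 /IHt et] prs] ints.
  have {}IHs : compress_forest (expand_forest s) = s.
    by apply: IHs => //; case: {prs} s ints => //= -[b u] s /andP[].
  have -> : compress_forest (expand_forest ((a, t) :: s)) =
      iter a.-1 (add_child DLeaf) (add_child t s).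
    rewrite /expand_forest /= -/(expand_forest s) cat_rcons.
    rewrite -[X in add_child t X]IHs -[X in add_child X _]et.
    by elim: a.-1 => //= k <-.
  have -> : add_child t s = (1, t) :: s.
    by case: {prs IHs} s ints => //= -[b u] s /andP[->].
  by rewrite add_leaves add1n prednK.
move=> b t s IHt IHs /and5P[pb s0 ints /IHt et prs].
rewrite compress_node et (IHs prs) ?pb //.
by case: (s) ints.
Qed.

Lemma nilp_compress_forest s : nilp (compress_forest s) = nilp s.
Proof.
case: s => // t s; rewrite /compress_forest /=.
by case: (foldr _ _ _) => //= -[a u] s'; case: ifP.
Qed.

Lemma compressK t :
  p_shape t -> proper (compress t) /\ expand (compress t) = t.
Proof.
move: t; apply: (ptree_forest_ind (Q := fun s => all p_shape s ->
  [/\ proper_forest (compress_forest s),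
      all d_internal (behead (belast DLeaf (unzip2 (compress_forest s))))
    & expand_forest (compress_forest s) = s]) _ _ _ _).1 => //.
  move=> t s IHt IHs /andP[/IHt [prt et] /IHs [prs ints es]].
  rewrite compress_forest_cons.
  have := nilp_compress_forest s.
  case: (compress_forest s) prs ints es => [|[a u] s'] prs ints es s0 /=.
by rewrite /expand_forest /= et prt; case: s s0 {es IHs}.
  case: ifPn => [it|].
    by split; [rewrite /= prt | rewrite /= it | rewrite /expand_forest /= et; congr cons].
  rewrite d_internal_compress => /p_internalPn ->.
  move: prs => /= /andP[/andP[a0 pru] prs]; split=> //; first by rewrite /= pru.
  by rewrite -es /expand_forest /= -[X in nseq X _](prednK a0).
move=> t s IHt IHs /=; rewrite ltnS => /and3P[s0 /IHt [prt et] /IHs [prs ints es]].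
rewrite -/(compress_forest s) -/(proper_forest (compress_forest s)) prt prs et.
rewrite -/(expand_forest (compress_forest s)) es andbT; split=> //.
have := nilp_compress_forest s.
case: (compress_forest s) ints => [|c s'] //= ints; last by rewrite ints.
by case: (s) s0.
Qed.

(** No inner child is a leaf. *)
Fixpoint tight (t : ptree) : bool :=
  let: PNode s := t in
  all p_internal (behead (belast leaf (behead s))) && all tight s.

Lemma tight_expand t :
  proper t -> tight (expand t) = all (pred1 1) (angle_labels t).
Proof.
move: t; apply: (dtree_forest_ind (Q := fun s =>
  proper_forest s -> all d_internal (behead (belast DLeaf (unzip2 s))) ->
  all p_internal (behead (belast leaf (expand_forest s))) &&
    all tight (expand_forest s) =
  all (pred1 1) (flatten [seq c.1 :: angle_labels c.2 | c <- s])) _ _ _ _).1 => //.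
  move=> a t s IHt IHs /andP[/andP[a0 /IHt et] prs].
  rewrite [unzip2 _]/= all_inner_cons => /andP[it /IHs es].
  have -> : all (pred1 1) (flatten [seq c.1 :: angle_labels c.2 | c <- (a, t) :: s])
      = [&& a == 1, all (pred1 1) (angle_labels t)
          & all (pred1 1) (flatten [seq c.1 :: angle_labels c.2 | c <- s])].
    by rewrite /= all_cat.
  rewrite -es // -et expand_forest_cons.
  case: a a0 => [//|[|a]] _; last by rewrite [_ ++ _]/= all_inner_cons /nilp size_cat addnS.
  rewrite all_inner_cons p_internal_expand nilp_expand_forest.
  have -> : nilp s || d_internal t by move: it; rewrite /nilp size_map.
  by rewrite /= andbCA.
move=> b t s IHt IHs /= /and5P[_ s0 ints /IHt et prs].
rewrite -/(expand_forest s) all_cat -et -IHs // 1?andbCA //.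
by case: (s) ints.
Qed.

Lemma Tinf2_plusE n m t :
  Tinf2_plus n m t <->
  [/\ proper t, d_internal t, deg_angle t = n & deg_node t = m].
Proof.
rewrite properE; split.
  move=> [[[it st at_ nt] [dn dm]] [t0 [s tE]]]; split=> //.
  by rewrite st at_; rewrite tE in nt *.
move=> [/and3P[st at_ nt] it dn dm].
case: t st at_ nt it dn dm => // b t s st at_ /andP[/= /eqP -> nt] it dn dm.
by split; [split | exists t, s].
Qed.

Lemma expand_bij n m : 0 < n -> set_bij (Tinf2_plus n m) (PT n m) expand.
Proof.
move=> n0; apply: (set_bij_can (g := compress)).
- move=> t /Tinf2_plusE [prt _ dn dm]; split; first exact: p_shape_expand.
    by rewrite p_leaves_expand ?dn.
  by rewrite p_internals_expand.
- move=> t [/compressK [prt et] ln im]; apply/Tinf2_plusE; split=> //.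
  + by rewrite d_internal_compress; case: t ln {prt et im} => -[|//] /=; lia.
  + by move: ln; rewrite -{1}et p_leaves_expand // => -[].
  + by rewrite -im -{2}et p_internals_expand.
- by move=> t /Tinf2_plusE [/expandK].
- by move=> t [/compressK []].
Qed.

Definition relabel0 (t : dtree) : dtree :=
  if t is DNode _ t0 s then DNode false t0 s else DLeaf.

Lemma beta_bij n m : set_bij (Tinf2_zero n m) (Tinf2_plus n m.+1) beta.
Proof.
apply: (set_bij_can (g := relabel0)); first exact: beta_fun.
- move=> t [[[_ sh ha hn] [da dn]] [t0 [s tE]]]; subst t.
  split; last by exists t0, s.
  by split; split=> //; case: dn.
- by move=> t [_ [t0 [s ->]]].
- by move=> t [_ [t0 [s ->]]].
Qed.

Lemma expand_beta t : expand (beta t) = expand t.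
Proof. by case: t. Qed.

(** * The word of a planar tree *)

(** The words of the children other than the leftmost one, each preceded by its
    separator. The separator [e] of the last child is V in a word, and D when
    the children are those of an erased root. *)
Fixpoint frame (e : step) (ws : seq (seq step)) : seq step :=
  if ws is u :: ws'
  then (if nilp ws' then e else Dstep) :: u ++ frame e ws' else [::].

Fixpoint word (t : ptree) : seq step :=
  let: PNode s := t in
  if [seq word u | u <- s] is u :: ws
  then Hstep :: u ++ frame Vstep ws else [::].

Definition words (s : seq ptree) : seq (seq step) := [seq word u | u <- s].

Definition forest_word (t : ptree) (s : seq ptree) : seq step :=
  word t ++ frame Dstep (words s).

Definition children_word (t : ptree) : seq step :=
  let: PNode s := t in if s is u :: s' then forest_word u s' else [::].

Lemma frame_cons e t s :
  frame e (words (t :: s)) =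
  (if nilp s then e else Dstep) :: word t ++ frame e (words s).
Proof. by rewrite /nilp /= /nilp size_map. Qed.

(** A node with k + 1 children adds one H, one V and k - 1 steps D to the words
    of its children. *)
Lemma word_counts :
  (forall t, p_shape t ->
     (path_x (word t)).+1 = p_leaves t /\
     (diag_steps (word t) + p_internals t).+1 = p_leaves t) /\
  (forall s, all p_shape s ->
     path_x (frame Vstep (words s)) + ~~ nilp s = sumn [seq p_leaves u | u <- s] /\
     diag_steps (frame Vstep (words s)) + ~~ nilp s
       + sumn [seq p_internals u | u <- s] = sumn [seq p_leaves u | u <- s]).
Proof.
apply: ptree_forest_ind => // [t s IHt IHs|t s IHt IHs].
  move=> /andP[/IHt [xt dt] /IHs [xs ds]]; rewrite frame_cons.
  rewrite /path_x /diag_steps /= in xt dt xs ds *; rewrite !count_cat.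
  by case: (nilp s) xs ds => /=; lia.
move=> /= /andP[s1 /andP[/IHt [xt dt] /IHs]]; rewrite -/(words s).
have -> : ~~ nilp s by rewrite /nilp; lia.
move=> [xs ds].
rewrite /path_x /diag_steps /= in xt dt xs ds *; rewrite !count_cat.
lia.
Qed.

Lemma frameD_counts s : all p_shape s ->
  path_x (frame Dstep (words s)) = sumn [seq p_leaves u | u <- s] /\
  diag_steps (frame Dstep (words s)) + sumn [seq p_internals u | u <- s] =
    sumn [seq p_leaves u | u <- s].
Proof.
elim: s => // t s IHs /= /andP[/(proj1 word_counts) [xt dt] /IHs [xs ds]].
rewrite if_same; rewrite /path_x /diag_steps /= in xt dt xs ds *.
rewrite !count_cat -/(words s); lia.
Qed.

(** * Schroeder paths *)

(** The height of a point is its excess of x over y. From height [h], the path [p]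
    stays at nonnegative heights and ends at height 0; [b] tells whether diagonal steps are allowed
    at height 0. *)
Fixpoint schroder (b : bool) (h : nat) (p : seq step) : bool :=
  match p with
  | [::] => h == 0
  | Hstep :: p' => schroder b h.+1 p'
  | Vstep :: p' => (0 < h) && schroder b h.-1 p'
  | Dstep :: p' => (b || (0 < h)) && schroder b h p'
  end.

(** Reading a word starts and ends at the same height and meets no D at that
    height, hence is possible at any height, even when D is forbidden at
    height 0. *)
Lemma schroder_word_cat :
  (forall t, p_shape t -> forall b h p,
     schroder b h (word t ++ p) = schroder b h p) /\
  (forall s, all p_shape s -> ~~ nilp s -> forall b h p,
     schroder b h.+1 (frame Vstep (words s) ++ p) = schroder b h p).
Proof.
apply: ptree_forest_ind => // [t s IHt IHs /andP[/IHt et shs] _ b h p|].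
  rewrite frame_cons /=; case: nilP => [->|/nilP s0] /=.
    by rewrite cats0 et.
  by rewrite orbT -catA et IHs.
move=> t s IHt IHs /= /and3P[s0 /IHt et shs] b h p.
by rewrite -/(words s) -catA et IHs // /nilp; lia.
Qed.

(** The separators D of a forest word are its diagonal steps on the diagonal. *)
Lemma schroder_forest_word b t s : p_shape t -> all p_shape s ->
  schroder b 0 (forest_word t s) = b || nilp s.
Proof.
move=> sht; rewrite /forest_word (proj1 schroder_word_cat) //.
elim: s => [|u s IHs] /=; first by rewrite orbT.
move=> /andP[shu /IHs es]; rewrite if_same orbF (proj1 schroder_word_cat) //= es.
by case: (b).
Qed.

Lemma schroderP h p : schroder true h p <->
  h + path_x p = path_y p /\ forall q r, p = q ++ r -> path_y q <= h + path_x q.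
Proof.
elim: p h => [|x p IH] h.
  split=> [/eqP ->|[] /=]; last by rewrite addn0 => ->.
  by split=> // -[|//] r.
have split_cons (k : nat) : (forall q r, p = q ++ r ->
      path_y (x :: q) <= h + path_x (x :: q)) <->
    (forall q r, x :: p = q ++ r -> path_y q <= h + path_x q).
  split=> H; last by move=> q r e; apply: (H (x :: q) r); rewrite e.
  by move=> [|y q] r //= [<-]; apply: H.
rewrite -split_cons //; case: x split_cons => _ /=.
- rewrite IH; rewrite /path_x /path_y /=; split=> -[e H]; split; try lia.
    by move=> q r /H; lia.
  by move=> q r /H; lia.
- split.
    move=> /andP[h0 /IH]; rewrite /path_x /path_y /= => -[e H]; split; first lia.
    by move=> q r /H; lia.
  rewrite /path_x /path_y /= => -[e H].
  have h0 : 0 < h by have := H [::] p erefl => /=; lia.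
  rewrite h0; apply/IH; rewrite /path_x /path_y; split; first lia.
  by move=> q r /H; lia.
- rewrite IH; rewrite /path_x /path_y /=; split=> -[e H]; split; try lia.
    by move=> q r /H; lia.
  by move=> q r /H; lia.
Qed.

Lemma strict_schroderP h p : schroder true h p ->
  schroder false h p <->
  forall q r, p = q ++ Dstep :: r -> h + path_x q <> path_y q.
Proof.
elim: p h => [|x p IH] h; first by move=> hp; split=> // _ [].
have split_cons : (x = Dstep -> h <> 0) /\
      (forall q r, p = q ++ Dstep :: r -> h + path_x (x :: q) <> path_y (x :: q)) <->
    (forall q r, x :: p = q ++ Dstep :: r -> h + path_x q <> path_y q).
  split=> [[H0 H]|H].
    move=> [|y q] r [xy]; last by rewrite -xy; apply: H.
    by move=> _; rewrite /path_x /path_y /= addn0; apply: H0.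
  split=> [xD|q r e]; last by apply: (H (x :: q) r); rewrite e.
  by have := H [::] p; rewrite xD /path_x /path_y /= addn0; apply.
rewrite -split_cons; case: x split_cons => _ /=.
- move=> /IH ->; rewrite /path_x /path_y /=; split=> [H|[_ H] q r /H]; last lia.
  by split=> // q r /H; lia.
- move=> /andP[h0 /IH]; rewrite h0 /= => ->.
  rewrite /path_x /path_y /=; split=> [H|[_ H] q r /H]; last lia.
  by split=> // q r /H; lia.
- move=> /IH sp; rewrite /path_x /path_y /=; split.
    move=> /andP[h0 /sp]; rewrite /path_x /path_y => H.
    by split=> [_|q r /H]; lia.
  move=> [h0 H]; apply/andP; split; first by have := h0 erefl; lia.
  by apply/sp; rewrite /path_x /path_y => q r /H; lia.
Qed.

Lemma schroder_weaken h p : schroder false h p -> schroder true h p.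
Proof.
elim: p h => [|[] p IH] h //=; first exact: IH.
  by move=> /andP[-> /IH].
by move=> /andP[_ /IH].
Qed.

Lemma SPE n m p :
  SP n m p <-> [/\ schroder true 0 p, path_x p = n & diag_steps p + m = n].
Proof.
split=> [[xp yp dp H]|[/schroderP [exy H] xp dp]].
  by split=> //; apply/schroderP; rewrite xp yp.
by split=> //; rewrite -exy.
Qed.

Lemma SP_plusE n m p :
  SP_plus n m p <-> [/\ schroder false 0 p, path_x p = n & diag_steps p + m = n].
Proof.
split=> [[/SPE [sp xp dp] nd]|[sp xp dp]].
  by split=> //; apply/strict_schroderP.
have wp := schroder_weaken sp.
by split; [apply/SPE | move=> q r; apply/(strict_schroderP wp).1].
Qed.

Lemma SP_zeroE n m p :
  SP_zero n m p <->
  [/\ schroder true 0 p, ~~ schroder false 0 p, path_x p = n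
    & diag_steps p + m = n].
Proof.
split=> [[Sp nSp]|[sp nsp xp dp]].
  have /SPE [sp xp dp] := Sp; split=> //; apply/negP => ssp.
  by apply: nSp; apply/SP_plusE.
by split; [apply/SPE | move=> /SP_plusE [ssp]; rewrite ssp in nsp].
Qed.

(** * Parsing paths *)

(** The state of the parser, which reads a path from its end: the tree whose word
    has just been read, then the lists of right siblings already read at the
    levels that have been entered by V and not yet left by H, innermost first,
    and finally the list of trees at the level of the diagonal. *)
Definition parse_state : Type := ptree * seq (seq ptree) * seq ptree.

(** H on an empty stack does not occur in Schroeder paths. *)
Definition parse_step (x : step) (st : parse_state) : parse_state :=
  let: (t, stack, bottom) := st in
  match x, stack with
  | Hstep, G :: stack' => (PNode (t :: G), stack', bottom)
  | Hstep, [::] => st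
  | Vstep, _ => (leaf, [:: t] :: stack, bottom)
  | Dstep, G :: stack' => (leaf, (t :: G) :: stack', bottom)
  | Dstep, [::] => (leaf, [::], t :: bottom)
  end.

Definition parse (p : seq step) : parse_state :=
  foldr parse_step (leaf, [::], [::]) p.

Lemma parse_word_cat :
  (forall t, p_shape t -> forall p stack bottom,
     parse p = (leaf, stack, bottom) ->
     parse (word t ++ p) = (t, stack, bottom)) /\
  (forall s, all p_shape s -> ~~ nilp s -> forall p stack bottom,
     parse p = (leaf, stack, bottom) ->
     parse (frame Vstep (words s) ++ p) = (leaf, s :: stack, bottom)).
Proof.
apply: ptree_forest_ind => // [t s IHt IHs /andP[/IHt et shs] _ p stk bot ep|].
  rewrite frame_cons /=; case: nilP => [->|/nilP s0] /=.
    by rewrite cats0 (et _ _ _ ep).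
  by rewrite -catA (et _ (s :: stk) bot) // (IHs shs s0 _ _ _ ep).
move=> t s IHt IHs /= /and3P[s0 /IHt et shs] p stk bot ep.
have {}s0 : ~~ nilp s by rewrite /nilp; lia.
by rewrite -/(words s) -catA (et _ (s :: stk) bot) // (IHs shs s0 _ _ _ ep).
Qed.

Lemma parse_forest_word t s : p_shape t -> all p_shape s ->
  parse (forest_word t s) = (t, [::], s).
Proof.
move=> sht shs; apply: (proj1 parse_word_cat) => //.
elim: s shs => // u s IHs /= /andP[shu /IHs es].
by rewrite if_same (proj1 parse_word_cat _ shu _ _ _ es).
Qed.

(** Every state with stack size [h] spells a path from height [h], and each step
    of the parser prepends the step read to this path. The inequalities on the
    heights provide the nonempty stack that H requires. *)
Lemma unparse h p : schroder true h p ->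
  let: (t, stack, bottom) := parse p in
  [/\ word t ++ flatten [seq frame Vstep (words G) | G <- stack]
        ++ frame Dstep (words bottom) = p,
      size stack = h,
      p_shape t /\ all p_shape bottom
    & all (fun G => ~~ nilp G && all p_shape G) stack].
Proof.
elim: p h => [|x p IH] h /=; first by move=> /eqP ->.
case: x; rewrite -/(parse p).
- move=> /IH; case: (parse p) => [[t [|G stk]] bot] [ep ss [sht shb]] //=.
  move=> /andP[/andP[G0 shG] shs]; case: ss => ss; split=> //.
    by rewrite -ep /= -/(words G) -!catA.
  by split=> //; rewrite sht shG andbT; move: G0; rewrite /nilp; lia.
- move=> /andP[h0 /IH]; case: (parse p) => [[t stk] bot] [ep ss [sht shb]] shs.
  split=> //=; [|by rewrite ss prednK|by rewrite sht].
  by rewrite -ep /= cats0 -catA.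
- move=> /IH; case: (parse p) => [[t [|G stk]] bot] [ep ss [sht shb]] shs /=.
    by split=> //; [rewrite if_same -ep | rewrite sht].
  move: shs => /= /andP[/andP[G0 shG] shs]; split=> //=.
    rewrite -ep /= -/(words G) /nilp size_map -/(nilp G) (negbTE G0).
    by rewrite -!catA.
  by rewrite sht shG.
Qed.

Lemma forest_word_surj p : schroder true 0 p ->
  exists t s, [/\ p = forest_word t s, p_shape t & all p_shape s].
Proof.
move=> /unparse; case: (parse p) => [[t [|G stk]] s] [] // <- _ [sht shs] _.
by exists t, s.
Qed.

Lemma word_forest1 t : word t = forest_word t [::].
Proof. by rewrite /forest_word cats0. Qed.

Lemma parse_word t : p_shape t -> parse (word t) = (t, [::], [::]).
Proof. by move=> sht; rewrite word_forest1 parse_forest_word. Qed.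

Lemma word_bij n m : set_bij (PT n m) (SP_plus n m) word.
Proof.
have countE t : p_shape t -> PT n m t <-> SP_plus n m (word t).
  move=> sht; have [xt dt] := proj1 word_counts t sht.
  have st : schroder false 0 (word t) by rewrite word_forest1 schroder_forest_word.
  split=> [[_ ln im]|/SP_plusE [_ xn dn]]; last by split=> //; lia.
  by apply/SP_plusE; split=> //; lia.
have wordS p : SP_plus n m p -> exists2 t, p = word t & p_shape t.
  move=> /SP_plusE [sp _ _].
  have [t [s [ep sht shs]]] := forest_word_surj (schroder_weaken sp).
  move: sp; rewrite ep schroder_forest_word // => /nilP ->.
  by exists t; rewrite ?word_forest1.
apply: (set_bij_can (g := fun p => (parse p).1.1)).
- by move=> t Pt; apply/countE => //; case: Pt.
- move=> p Sp; have [t ep sht] := wordS p Sp.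
  by rewrite ep parse_word //; apply/countE; rewrite -?ep.
- by move=> t [sht _ _]; rewrite parse_word.
- by move=> p /wordS [t -> sht]; rewrite parse_word.
Qed.

Lemma children_word_bij n m : set_bij (PT n m.+1) (SP_zero n m) children_word.
Proof.
have countE t s : p_shape t -> all p_shape s -> 0 < size s ->
    PT n m.+1 (PNode (t :: s)) <-> SP_zero n m (forest_word t s).
  move=> sht shs s0.
  have [xt dt] := proj1 word_counts t sht; have [xs ds] := frameD_counts shs.
  have s0' : nilp s = false by apply/negbTE; rewrite /nilp; lia.
  rewrite SP_zeroE !schroder_forest_word // s0' /PT /=.
  rewrite /path_x /diag_steps /= in xt dt xs ds *; rewrite !count_cat.
  by split=> [[_ ln im]|[_ _ xn dn]]; split; rewrite ?ltnS ?s0 ?sht ?shs //; lia.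
have children_wordS p : SP_zero n m p -> exists t s,
    [/\ p = forest_word t s, p_shape t, all p_shape s & 0 < size s].
  move=> /SP_zeroE [sp nsp _ _].
  have [t [s [ep sht shs]]] := forest_word_surj sp.
  exists t, s; split=> //.
  by move: nsp; rewrite ep schroder_forest_word // /nilp /=; lia.
have PTnode t : PT n m.+1 t -> exists t0 s,
    [/\ t = PNode (t0 :: s), p_shape t0, all p_shape s & 0 < size s].
  by case: t => -[|t s] [] //= /and3P[s0 sht shs] _ _; exists t, s.
apply: (set_bij_can (g := fun p => PNode ((parse p).1.1 :: (parse p).2))).
- move=> t Pt; have [t0 [s [tE sht shs s0]]] := PTnode t Pt.
  by rewrite tE; apply/countE; rewrite -?tE.
- move=> p Sp; have [t [s [ep sht shs s0]]] := children_wordS p Sp.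
  by rewrite ep parse_forest_word //; apply/countE; rewrite -?ep.
- by move=> t /PTnode [t0 [s [-> sht shs s0]]]; rewrite /= parse_forest_word.
- by move=> p /children_wordS [t [s [-> sht shs s0]]]; rewrite parse_forest_word.
Qed.

(** * Trees with all angle labels equal to 1 *)

(** The empty path is accepted: a D may be the last step of a path. *)
Definition starts_H (p : seq step) : bool :=
  if p is x :: _ then (if x is Hstep then true else false) else true.

Fixpoint D_then_H (p : seq step) : bool :=
  if p is x :: p'
  then (if x is Dstep then starts_H p' else true) && D_then_H p' else true.

Lemma D_then_HP p : D_then_H p <->
  forall q r, p = q ++ Dstep :: r -> r = [::] \/ exists r', r = Hstep :: r'.
Proof.
elim: p => [|x p IH] /=; first by split=> // _ [].
split=> [/andP[xp /IH H] [|y q] r [ex ep]|H].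
- rewrite ex ep in xp; case: r xp {ep} => [|[] r] //; first by left.
  by move=> _; right; exists r.
- exact: H ep.
apply/andP; split; last by apply/IH => q r ep; apply: (H (x :: q)); rewrite ep.
case: x H => // H; have [->//|[r' -> //]] := H [::] p erefl.
Qed.

Lemma starts_H_word t p : starts_H (word t ++ p) = p_internal t || starts_H p.
Proof. by case: t => -[]. Qed.

(** The last step of a nonempty word is V, so that the condition on the word is
    independent of what follows it. *)
Lemma D_then_H_word_cat :
  (forall t, p_shape t -> forall p,
     D_then_H (word t ++ p) = tight t && D_then_H p) /\
  (forall s, all p_shape s -> ~~ nilp s -> forall p,
     D_then_H (frame Vstep (words s) ++ p) =
     [&& all p_internal (behead (belast leaf s)), all tight s & D_then_H p]).
Proof.
apply: ptree_forest_ind => // [t s IHt IHs /andP[/IHt et shs] _ p|].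
  rewrite frame_cons all_inner_cons /=; case: nilP => [->|/nilP s0] /=.
    by rewrite cats0 et andbT.
  rewrite -catA et IHs // starts_H_word.
  have -> : starts_H (frame Vstep (words s) ++ p) = false.
    by case: (s) s0 => //= u s' _; case: (nilp _).
  by rewrite orbF -!andbA; do !bool_congr.
move=> t s IHt IHs /= /and3P[s1 /IHt et shs] p.
rewrite -/(words s) -catA et IHs //; last by rewrite /nilp; lia.
by rewrite andbCA -!andbA.
Qed.

Lemma D_then_H_frameD s : all p_shape s ->
  D_then_H (frame Dstep (words s)) =
  all p_internal (behead (belast leaf s)) && all tight s.
Proof.
elim: s => // t s IHs /andP[sht /IHs es].
rewrite frame_cons if_same all_inner_cons /= (proj1 D_then_H_word_cat) // es.
rewrite starts_H_word.
have -> : starts_H (frame Dstep (words s)) = nilp s.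
  by case: (s) => //= u s'; rewrite if_same.
by rewrite orbC; do !case: (all _ _); rewrite ?andbF ?andbT.
Qed.

Lemma D_then_H_word t : p_shape t -> D_then_H (word t) = tight t.
Proof.
by move=> sht; rewrite -[word t]cats0 (proj1 D_then_H_word_cat) // andbT.
Qed.

Lemma D_then_H_children_word t : p_shape t -> D_then_H (children_word t) = tight t.
Proof.
case: t => -[|t s] //= /and3P[_ sht shs].
by rewrite /forest_word (proj1 D_then_H_word_cat) // D_then_H_frameD // andbCA.
Qed.

Lemma T22_plusE n m :
  T22_plus n m = Tinf2_plus n m `&` [set t | all (pred1 1) (angle_labels t)].
Proof. by apply/seteqP; split=> t; [case=> -[[]] | case=> -[[]]]. Qed.

Lemma T22_zeroE n m :
  T22_zero n m = Tinf2_zero n m `&` [set t | all (pred1 1) (angle_labels t)].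
Proof. by apply/seteqP; split=> t; [case=> -[[]] | case=> -[[]]]. Qed.

Lemma RP_plusE n m : RP_plus n m = SP_plus n m `&` [set p | D_then_H p].
Proof.
apply/seteqP; split=> p.
  by move=> [[Sp /D_then_HP dp] np].
by move=> [[Sp np] dp]; split=> //; split=> //; apply/D_then_HP.
Qed.

Lemma RP_zeroE n m : RP_zero n m = SP_zero n m `&` [set p | D_then_H p].
Proof.
apply/seteqP; split=> p.
  move=> [Rp nRp]; have [Sp dp] := Rp; split; last exact/D_then_HP.
  by split=> // -[_ np]; apply: nRp.
move=> [[Sp nSp] /D_then_HP dp]; split=> // -[_ np].
exact: nSp.
Qed.

Lemma unit_angles_D_then_H t : proper t ->
  all (pred1 1) (angle_labels t) <-> D_then_H (word (expand t)).
Proof.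
by move=> prt; rewrite D_then_H_word ?tight_expand //; exact: p_shape_expand.
Qed.

Definition tree_of_path (p : seq step) : ptree := (parse p).1.1.

Lemma angle_labels_beta t : d_internal t -> angle_labels (beta t) = angle_labels t.
Proof. by case: t. Qed.

Theorem proposition3p1 :
  exists (fplus : nat -> nat -> dtree -> ptree)
         (gplus : nat -> nat -> ptree -> seq step)
         (fzero : nat -> nat -> dtree -> ptree)
         (gzero : nat -> nat -> ptree -> seq step)
         (T : nat -> nat -> seq step -> seq step),
  forall n m : nat, 1 <= n ->
  let phiplus (k : nat) (t : dtree) := gplus n k (fplus n k t) in
  let phizero (k : nat) (t : dtree) := gzero n k (fzero n k t) in
  [/\ (set_bij (Tinf2_plus n m) (PT n m) (fplus n m) /\
       set_bij (PT n m) (SP_plus n m) (gplus n m)),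
      [/\ set_bij (Tinf2_zero n m) (PT n m.+1) (fzero n m),
          set_bij (PT n m.+1) (SP_zero n m) (gzero n m),
          set_bij (SP_plus n m.+1) (SP_zero n m) (T n m)
        & forall t : dtree, Tinf2_zero n m t ->
            phizero m t = T n m (phiplus m.+1 (beta t))]
    & set_bij (T22_plus n m) (RP_plus n m) (phiplus m) /\
      set_bij (T22_zero n m) (RP_zero n m) (phizero m)].
Proof.
exists (fun _ _ => expand), (fun _ _ => word), (fun _ _ => expand),
  (fun _ _ => children_word), (fun _ _ p => children_word (tree_of_path p)) => n m n1 /=.
have T_word t : p_shape t -> children_word (tree_of_path (word t)) = children_word t.
  by move=> sht; rewrite /tree_of_path parse_word.
have betaP t : Tinf2_zero n m t -> proper (beta t).
  by move=> /beta_fun /Tinf2_plusE [].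
have expand0_bij : set_bij (Tinf2_zero n m) (PT n m.+1) expand.
  rewrite -(funext expand_beta : expand \o beta = expand).
  exact: set_bij_comp (beta_bij n m) (expand_bij m.+1 n1).
split; first by split; [exact: expand_bij | exact: word_bij].
- split=> //; first exact: children_word_bij.
    apply: set_bij_factor (word_bij n m.+1) _.
    apply: eq_set_bijLR (children_word_bij n m) => t; rewrite inE => -[sht _ _].
    exact: T_word.
  move=> t /betaP prt.
  by rewrite T_word ?expand_beta // -expand_beta p_shape_expand.
rewrite T22_plusE T22_zeroE RP_plusE RP_zeroE; split.
  apply: set_bij_sep (set_bij_comp (expand_bij m n1) (word_bij n m)).
  by move=> t /Tinf2_plusE [prt _ _ _]; apply: unit_angles_D_then_H.
apply: set_bij_sep (set_bij_comp expand0_bij (children_word_bij n m)) => t Tt.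
have /betaP prt := Tt.
have [[[it _ _ _] _] _] := Tt.
rewrite /= -expand_beta D_then_H_children_word ?p_shape_expand // tight_expand //.
by rewrite angle_labels_beta.
Qed.
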